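(* Let $a,b,c\in\mathbb{C}$ with $a\neq 0$ and $b^2-4ac\neq 0$, and let $r_1,r_2$ be the two distinct complex roots of $f(x)=ax^2+bx+c$. For each integer $n\geq 0$ define polynomials $P_n,Q_n\in\mathbb{C}[x]$ by $$P_n(x)=\frac{a^{2^n-1}}{r_1-r_2}\left(r_1(x-r_2)^{2^n}-r_2(x-r_1)^{2^n}\right),\qquad Q_n(x)=\frac{a^{2^n-1}}{r_1-r_2}\left((x-r_2)^{2^n}-(x-r_1)^{2^n}\right).$$ Then for every integer $n\geq 0$, $$P_n(x)=a^{2^n-1}x^{2^n}-\sum_{k=0}^{2^n-2}\ \sum_{j=0}^{2^n-k-2}(-1)^j\binom{2^n}{k}\binom{2^n-k-j-2}{j}a^{k+j}b^{2^n-k-2j-2}c^{j+1}x^k$$ and $$Q_n(x)=\sum_{k=0}^{2^n-1}\ \sum_{j=0}^{2^n-k-1}(-1)^j\binom{2^n}{k}\binom{2^n-k-j-1}{j}a^{k+j}b^{2^n-k-2j-1}c^jx^k.$$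
   Context: Conventions: $\binom{m}{j}=0$ for integers $0\leq m<j$; a summand whose binomial coefficient is $0$ is taken to be $0$, even if the formal exponent of $b$ in it is negative (the exponent of $b$ is negative only in such summands); zeroth powers equal $1$, including $0^0=1$; empty sums are $0$. *)

(* Defs.v *)
From HB Require Import structures.
From mathcomp Require Import all_boot all_order all_algebra.
From mathcomp Require Import reals.
From mathcomp.real_closed Require Import complex.

Set Implicit Arguments.
Unset Strict Implicit.
Unset Printing Implicit Defensive.

Import Order.TTheory GRing.Theory Num.Theory.
Local Open Scope ring_scope.
Local Open Scope complex_scope.

Definition quadratic (R : realType) (a b c : R[i]) : {poly R[i]} :=
  a *: 'X^2 + b *: 'X + c%:P.

Definition P_ (R : realType) (a r1 r2 : R[i]) (n : nat) : {poly R[i]} :=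
  (a ^+ (2 ^ n - 1) / (r1 - r2)) *:
    (r1 *: ('X - r2%:P) ^+ (2 ^ n) - r2 *: ('X - r1%:P) ^+ (2 ^ n)).

Definition Q_ (R : realType) (a r1 r2 : R[i]) (n : nat) : {poly R[i]} :=
  (a ^+ (2 ^ n - 1) / (r1 - r2)) *:
    (('X - r2%:P) ^+ (2 ^ n) - ('X - r1%:P) ^+ (2 ^ n)).

(* Main.v *)
Require Import Defs.
From HB Require Import structures.
From mathcomp Require Import all_boot all_order all_algebra.
From mathcomp Require Import reals.
From mathcomp.real_closed Require Import complex.
From mathcomp Require Import zify ring.
Import Order.TTheory GRing.Theory Num.Theory.
Local Open Scope ring_scope.
Local Open Scope complex_scope.

(* By Vieta, s_i = - a r_i satisfy s_1 + s_2 = b and s_1 s_2 = a c, so the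
   coefficient of 'X^k in Q_n is 'C(N, k) a^k times the quotient
   (s_2^m - s_1^m) / (s_2 - s_1) with N = 2^n and m = N - k.  This quotient is
   the Lucas sequence U_m(b, a c), whose expansion in powers of b and a c is the
   inner sum.  For P_n, r_1 (- r_2)^m - r_2 (- r_1)^m carries a factor
   - r_1 r_2 = - c / a when 0 < m, which lowers the index m by one. *)

Definition lucasU (A : comNzRingType) (b q : A) (m : nat) : A :=
  \sum_(0 <= j < m)
    (-1) ^+ j * 'C(m - j - 1, j)%:R * b ^+ (m - 2 * j - 1) * q ^+ j.

(** Pascal's rule splits the summand [i.+1] on the left: the part with ['C(m - i - 1, i.+1)] goes to
    [b * U_(m+1)], the part with ['C(m - i - 1, i)] to [- q * U_m]. *)
Lemma lucasU_rec (A : comNzRingType) (b q : A) (m : nat) :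
  lucasU A b q m.+2 = b * lucasU A b q m.+1 - q * lucasU A b q m.
Proof.
rewrite /lucasU big_nat_recl // big_nat_recr //=.
rewrite [X in b * X]big_nat_recl //.
rewrite (_ : (m.+2 - m.+1 - 1 = 0)%N); last by lia.
rewrite bin0n mulr0 !mul0r addr0 mulrDr -addrA; congr (_ + _).
  by rewrite !bin0 muln0 !subn0 !subn1 /= !expr0 !mulr1 !mul1r exprS.
rewrite !mulr_sumr -sumrB; apply: eq_big_nat => i /andP[_ im].
rewrite (_ : (m.+2 - i.+1 - 1 = (m - i - 1).+1)%N); last by lia.
rewrite (_ : (m.+1 - i.+1 - 1 = m - i - 1)%N); last by lia.
rewrite (_ : (m.+2 - 2 * i.+1 - 1 = m - 2 * i - 1)%N); last by lia.
rewrite binS natrD.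
(* In the first case the exponent of [b] in the [U_(m+1)] summand is truncated, but its binomial
   coefficient is 0. *)
have [lt|ge] := ltnP (m - i - 1) i.+1.
  by rewrite bin_small // !exprS; ring.
rewrite (_ : (m - 2 * i - 1 = (m.+1 - 2 * i.+1 - 1).+1)%N); last by lia.
by rewrite !exprS; ring.
Qed.

(** Both sides satisfy [x_(m+2) = (s + t) x_(m+1) - s t x_m] and agree at [m = 0] and [m = 1]. *)
Lemma subr_expr_lucasU (A : comNzRingType) (s t : A) (m : nat) :
  t ^+ m - s ^+ m = (t - s) * lucasU A (s + t) (s * t) m.
Proof.
elim/ltn_ind: m => -[|[|m]] IH.
- by rewrite /lucasU big_geq // mulr0 subrr.
- by rewrite /lucasU big_nat1 bin0 !expr0 !mulr1.
rewrite lucasU_rec mulrBr !(mulrCA (t - s)) -!IH //.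
by rewrite !exprS; ring.
Qed.

Lemma quadratic_vieta (F : fieldType) (a b c r1 r2 : F) :
  r1 != r2 -> a * r1 ^+ 2 + b * r1 + c = 0 -> a * r2 ^+ 2 + b * r2 + c = 0 ->
  b = - a * r1 - a * r2 /\ c = a * r1 * r2.
Proof.
move=> hr e1 e2; have hd : r1 - r2 != 0 by rewrite subr_eq0.
have eb : b = - a * r1 - a * r2.
  (* Subtracting the two root equations gives [(r1 - r2) * (b + a * r1 + a * r2) = 0]. *)
  apply: (mulfI hd); apply/eqP; rewrite -subr_eq0; apply/eqP.
  transitivity ((a * r1 ^+ 2 + b * r1 + c) - (a * r2 ^+ 2 + b * r2 + c)).
    by ring.
  by rewrite e1 e2 subrr.
split=> //; move: e1; rewrite eb => e1.
by rewrite -[LHS]subr0 -e1; ring.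
Qed.

Lemma XsubC_exp (A : comNzRingType) (r : A) (N : nat) :
  ('X - r%:P) ^+ N =
    \sum_(0 <= k < N.+1) ('C(N, k)%:R * (- r) ^+ (N - k)) *: 'X^k.
Proof.
rewrite addrC exprDn big_mkord; apply: eq_bigr => k _.
by rewrite -polyCN -polyC_exp mul_polyC scalerMnl mulr_natl.
Qed.

Lemma scaled_root_diff (F : fieldType) (a r1 r2 : F) (N k : nat) :
  a != 0 -> r1 != r2 -> (0 < N)%N -> (k <= N)%N ->
  a ^+ (N - 1) / (r1 - r2) * ((- r2) ^+ (N - k) - (- r1) ^+ (N - k)) =
  a ^+ k * lucasU F (- a * r1 - a * r2) (a * (a * r1 * r2)) (N - k).
Proof.
move=> ha hr N0 kN; have hd : r1 - r2 != 0 by rewrite subr_eq0.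
have := subr_expr_lucasU F (- a * r1) (- a * r2) (N - k).
rewrite (_ : - a * r1 * (- a * r2) = a * (a * r1 * r2)); last by ring.
rewrite (_ : - a * r1 + - a * r2 = - a * r1 - a * r2); last by ring.
set U := lucasU _ _ _ _; rewrite !mulNr -!mulrN !exprMn.
rewrite -!mulrBr => e.
(* This factor clears the denominator and completes [a ^+ (N - 1)] to
   [a ^+ N = a ^+ k * a ^+ (N - k)]. *)
apply: (mulfI (mulf_neq0 ha hd)).
transitivity (a ^+ k * (a ^+ (N - k) * ((- r2) ^+ (N - k) - (- r1) ^+ (N - k)))).
  have aN : a ^+ N = a * a ^+ (N - 1) by rewrite -exprS subn1 prednK.
  rewrite [RHS]mulrA -exprD subnKC // aN.
  by field.
by rewrite e; ring.
Qed.

Lemma quadratic_newton_Q (F : fieldType) (a r1 r2 : F) (N : nat) :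
  a != 0 -> r1 != r2 -> (0 < N)%N ->
  (a ^+ (N - 1) / (r1 - r2)) *: (('X - r2%:P) ^+ N - ('X - r1%:P) ^+ N) =
  \sum_(0 <= k < N)
    ('C(N, k)%:R * a ^+ k *
       lucasU F (- a * r1 - a * r2) (a * (a * r1 * r2)) (N - k)) *: 'X^k.
Proof.
move=> ha hr N0; rewrite !XsubC_exp -sumrB big_nat_recr //= subnn !expr0.
rewrite subrr addr0 scaler_sumr; apply: eq_big_nat => k /andP[_ kN].
rewrite -mulrA -scaled_root_diff ?(ltnW kN) // -scalerBl scalerA.
by congr (_ *: _); ring.
Qed.

Lemma quadratic_newton_P (F : fieldType) (a r1 r2 : F) (N : nat) :
  a != 0 -> r1 != r2 -> (0 < N)%N ->
  (a ^+ (N - 1) / (r1 - r2)) *: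
    (r1 *: ('X - r2%:P) ^+ N - r2 *: ('X - r1%:P) ^+ N) =
  a ^+ (N - 1) *: 'X^N -
  \sum_(0 <= k < N - 1)
    ('C(N, k)%:R * a ^+ k * (a * r1 * r2) *
       lucasU F (- a * r1 - a * r2) (a * (a * r1 * r2)) (N - k - 1)) *: 'X^k.
Proof.
case: N => // N ha hr _; have hd : r1 - r2 != 0 by rewrite subr_eq0.
rewrite !XsubC_exp !scaler_sumr -sumrB scaler_sumr big_nat_recr //= addrC.
rewrite subn1 /=; congr (_ + _).
  rewrite !scalerA -scalerBl scalerA binn subnn !expr0 !mulr1.
  by congr (_ *: _); field.
(* The summand [k = N], one below the top degree, vanishes since [r1 * (- r2) - r2 * (- r1) = 0]. *)
rewrite big_nat_recr //= -sumrN -[RHS]addr0; congr (_ + _); last first.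
  rewrite !scalerA -scalerBl scalerA subSnn !expr1.
  by rewrite (_ : _ * _ = 0) ?scale0r //; ring.
apply: eq_big_nat => k /andP[_ kN].
rewrite !scalerA -scalerBl scalerA -scaleNr; congr (_ *: _).
rewrite (_ : (N.+1 - k - 1 = N.+1 - k.+1)%N); last by lia.
(* Using [k.+1] lowers the Lucas index by one; the additional [a] in [a ^+ k.+1] joins [r1 * r2] to
   form [a * r1 * r2]. *)
have := scaled_root_diff F a r1 r2 N.+1 k.+1 ha hr isT (leqW kN).
rewrite subn1 /=; set U := lucasU _ _ _ _.
rewrite (subSn (ltnW kN)) subSS !exprS => e.
transitivity (- ('C(N.+1, k)%:R * r1 * r2) *
  (a ^+ N / (r1 - r2) * ((- r2) ^+ (N - k) - (- r1) ^+ (N - k)))).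
  by ring.
by rewrite e; ring.
Qed.

(* MathComp world.  Upper summation bounds are exclusive.  Exponents and
   binomial arguments use truncated subtraction on nat; on the given ranges only
   the exponent of b can be truncated, and only in summands whose second
   binomial coefficient is 0. *)
Theorem theorem1 (R : realType) (a b c r1 r2 : R[i])
    (ha : a != 0) (hdisc : b ^+ 2 - 4%:R * a * c != 0)
    (hr : r1 != r2)
    (hr1 : root (quadratic a b c) r1) (hr2 : root (quadratic a b c) r2)
    (n : nat) :
  P_ a r1 r2 n =
    a ^+ (2 ^ n - 1) *: 'X^(2 ^ n)
    - \sum_(0 <= k < 2 ^ n - 1) \sum_(0 <= j < 2 ^ n - k - 1)
        ((-1) ^+ j * 'C(2 ^ n, k)%:R * 'C(2 ^ n - k - j - 2, j)%:R
           * a ^+ (k + j) * b ^+ (2 ^ n - k - 2 * j - 2) * c ^+ (j + 1))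
        *: 'X^k
  /\
  Q_ a r1 r2 n =
    \sum_(0 <= k < 2 ^ n) \sum_(0 <= j < 2 ^ n - k)
        ((-1) ^+ j * 'C(2 ^ n, k)%:R * 'C(2 ^ n - k - j - 1, j)%:R
           * a ^+ (k + j) * b ^+ (2 ^ n - k - 2 * j - 1) * c ^+ j)
        *: 'X^k.
Proof.
have N0 : (0 < 2 ^ n)%N by rewrite expn_gt0.
have [||eb ec] := quadratic_vieta _ a b c r1 r2 hr.
- by move: hr1; rewrite /root /quadratic !hornerE => /eqP.
- by move: hr2; rewrite /root /quadratic !hornerE => /eqP.
rewrite /P_ /Q_ quadratic_newton_P // quadratic_newton_Q // -ec -eb.
split; [congr (_ - _)|]; apply: eq_big_nat => k _;
  rewrite -scaler_suml; congr (_ *: _);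
  rewrite /lucasU mulr_sumr; apply: eq_bigr => j _.
- rewrite (_ : (2 ^ n - k - 1 - j - 1 = 2 ^ n - k - j - 2)%N); last by lia.
  rewrite (_ : (2 ^ n - k - 1 - 2 * j - 1 = 2 ^ n - k - 2 * j - 2)%N);
    last by lia.
  by rewrite exprMn !exprD expr1; ring.
- by rewrite exprMn exprD; ring.
Qed.
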